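(* Let $X_n$ be a nonempty metric space for every $n\in\mathbb{N}$. Then for the space $X=\prod_n X_n$ the following are equivalent: (a) $X$ is ULC; (b) each space $X_n$ is ULC and all but finitely many of the spaces $X_n$ are connected.
   Context: A metric space $X$ is uniformly locally connected (ULC) if for every $\varepsilon>0$ there is $\delta>0$ such that any two points of $X$ at distance $<\delta$ lie in a connected subset of $X$ of diameter $<\varepsilon$. Metrics are assumed to be bounded by $1$ (only uniform properties matter), and a countably infinite product $\prod_n X_n$ of metric spaces $(X_n,d_n)$ carries the metric $d(x,y)=\sum_n \frac{1}{2^n}d_n(x_n,y_n)$. *)

(* Defs.v *)
From HB Require Import structures.
From mathcomp Require Import all_boot all_order all_algebra.
From mathcomp Require Import all_classical all_reals all_analysis.

Set Implicit Arguments.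
Unset Strict Implicit.
Unset Printing Implicit Defensive.

Import Order.TTheory GRing.Theory Num.Theory.
Import numFieldNormedType.Exports.

Local Open Scope classical_set_scope.
Local Open Scope ring_scope.

(* Valued in the extended reals, so that it is also meaningful on unbounded
   sets; the diameter of the empty set is -oo. *)
Definition diameter (R : realType) (T : metricType R) (A : set T) : \bar R :=
  ereal_sup [set (mdist p.1 p.2)%:E | p in A `*` A].

Definition ULC (R : realType) (T : metricType R) : Prop :=
  forall e : R, 0 < e -> exists2 d : R, 0 < d &
    forall x y : T, mdist x y < d ->
      exists A : set T, [/\ A x, A y, connected A & (diameter A < e%:E)%E].

Definition bounded_by1 (R : realType) (T : metricType R) : Prop :=
  forall x y : T, mdist x y <= 1.

(* The bound does not occur in the carrier; it is a parameter because the
   metric structure declared below is only available when the series defining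
   the distance converges. *)
Definition countable_prod (R : realType) (X : nat -> metricType R)
  (X1 : forall n, bounded_by1 (X n)) : Type := forall n, X n.

Section countable_prod_metric.
Context {R : realType} (X : nat -> metricType R)
  (X1 : forall n, bounded_by1 (X n)).
Local Notation P := (countable_prod X1).
Implicit Types x y z : P.

Definition prod_term x y : R^nat := fun n => (2 ^+ n)^-1 * mdist (x n) (y n).

Definition prod_dist x y : R := limn (series (prod_term x y)).

Lemma prod_term_ge0 x y n : 0 <= prod_term x y n.
Proof. by rewrite mulr_ge0 ?mdist_ge0// invr_ge0 exprn_ge0. Qed.

Lemma is_cvg_prod_term x y : cvgn (series (prod_term x y)).
Proof.
apply: (@series_le_cvg _ _ (geometric 1 2^-1)).
- exact: prod_term_ge0.
- by move=> n; rewrite /= mul1r exprn_ge0.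
- move=> n; rewrite /geometric/= mul1r exprVn ler_piMr ?invr_ge0 ?exprn_ge0//.
  exact: X1.
- by apply: is_cvg_geometric_series; rewrite ger0_norm// invf_lt1// ltr1n.
Qed.

Lemma prod_distxx x : prod_dist x x = 0.
Proof.
rewrite /prod_dist (_ : series _ = fun=> 0) ?lim_cst//.
apply/funext => n; rewrite /series/= big1// => i _.
by rewrite /prod_term mdistxx mulr0.
Qed.

Lemma prod_term_le_dist x y n : prod_term x y n <= prod_dist x y.
Proof.
apply: (@le_trans _ _ (series (prod_term x y) n.+1)).
  by rewrite seriesSr lerDr sumr_ge0// => i _; exact: prod_term_ge0.
apply: nondecreasing_cvgn_le; last exact: is_cvg_prod_term.
by apply: nondecreasing_series => i _ _; exact: prod_term_ge0.
Qed.

Lemma prod_dist_positivity x y : prod_dist x y = 0 -> x = y.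
Proof.
move=> xy0; apply: functional_extensionality_dep => n.
apply: (@mdist_positivity R); apply/eqP; rewrite eq_le mdist_ge0 andbT.
by have := prod_term_le_dist x y n; rewrite xy0 /prod_term pmulr_rle0.
Qed.

Lemma prod_dist_sym x y : prod_dist x y = prod_dist y x.
Proof.
rewrite /prod_dist; congr (limn (series _)).
by apply/funext => n; rewrite /prod_term metric_sym.
Qed.

Lemma prod_dist_triangle y x z : prod_dist x z <= prod_dist x y + prod_dist y z.
Proof.
have cxy := @is_cvg_prod_term x y; have cyz := @is_cvg_prod_term y z.
rewrite /prod_dist -lim_seriesD//; apply: lim_series_le.
- exact: is_cvg_prod_term.
- exact: is_cvg_seriesD.
- move=> n; apply: (@le_trans _ _ (prod_term x y n + prod_term y z n)) => //.
  by rewrite /prod_term -mulrDr ler_wpM2l ?invr_ge0 ?exprn_ge0// metric_triangle.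
Qed.

HB.instance Definition _ := gen_eqMixin P.
HB.instance Definition _ := gen_choiceMixin P.
HB.instance Definition _ := isMetric.Build R P
  prod_distxx prod_dist_positivity prod_dist_sym prod_dist_triangle.

End countable_prod_metric.

(* Main.v *)
Require Import Defs.
From mathcomp Require Import all_boot all_order all_algebra.
From mathcomp Require Import all_classical all_reals all_analysis.
From mathcomp Require Import lra.

(** The projection of the product to its [n]-th factor is Lipschitz with
    constant [2 ^ n], and the slice through a base point in direction [n] is
    Lipschitz with constant [2 ^ -n]: on a slice the product distance is the
    distance of the factor scaled by [2 ^ -n].

    Suppose that the product is ULC, and let [d] answer to [e].  Two points of
    the [n]-th factor at distance less than [2 ^ n * d] are put on a slice,
    joined there by a connected set of diameter less than [e], and projected
    back: they lie in a connected set of diameter less than [2 ^ n * e]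
    ([ULC_prod_coord]).  For fixed [n] this says that the factor is ULC.  For
    fixed [e], all points of the [n]-th factor are that close as soon as
    [2 ^ n * d > 1], because the metrics are bounded by 1; hence all but
    finitely many factors are connected.

    Conversely, the coordinates from [M] on contribute at most [2 * 2 ^ -M] to
    a distance, so they can be left free where the factors are connected.
    In the finitely many remaining coordinates two close points are joined by
    small connected sets, and the product of all these sets is small
    ([mdist_prod_le]).  It is connected ([connected_prod]): changing one
    coordinate at a time stays in one connected component, and the points
    that agree with a given one from some coordinate on are dense. *)
Import Order.TTheory GRing.Theory Num.Theory.

Local Open Scope classical_set_scope.
Local Open Scope ring_scope.

(** * Lipschitz maps, diameters and connected sets *)

Section metric_facts.
Context {R : realType}.

Lemma lipschitz_continuous (T U : metricType R) (k : R) (f : T -> U) :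
  0 < k -> (forall x y, mdist (f x) (f y) <= k * mdist x y) -> continuous f.
Proof.
move=> k0 fk x; apply/metricType_numDomainType.cvgrPdist_lt => e e0.
apply/nbhs_ballP; exists (e / k); first by rewrite /= divr_gt0.
move=> y; rewrite ballEmdist /= ltr_pdivlMr// mulrC => xy.
exact: le_lt_trans (fk _ _) xy.
Qed.

Lemma mdist_le_diameter {T : metricType R} {A : set T} {x y : T} :
  A x -> A y -> ((mdist x y)%:E <= diameter A)%E.
Proof. by move=> Ax Ay; apply: ereal_sup_ubound; exists (x, y). Qed.

Lemma diameter_le {T : metricType R} (A : set T) (c : \bar R) :
  (forall x y, A x -> A y -> ((mdist x y)%:E <= c)%E) -> (diameter A <= c)%E.
Proof. by move=> Ac; apply: ge_ereal_sup => _ [[x y] [Ax Ay] <-]; exact: Ac. Qed.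

(** The means by which small connected sets are carried between the product
    and its factors; [e] is scaled by the Lipschitz constant. *)
Lemma lipschitz_image (T U : metricType R) (k e : R) (f : T -> U) (A : set T) :
  0 < k -> (forall x y, mdist (f x) (f y) <= k * mdist x y) ->
  connected A -> (diameter A < e%:E)%E ->
  connected (f @` A) /\ (diameter (f @` A) < (k * e)%:E)%E.
Proof.
move=> k0 fk cA dA; split.
  apply: connected_continuous_connected => //.
  apply: continuous_subspaceT; exact: lipschitz_continuous k0 fk.
apply: (@le_lt_trans _ _ (k%:E * diameter A)%E); last first.
  by rewrite EFinM lte_pmul2l// lte_fin.
apply: diameter_le => _ _ [x Ax <-] [y Ay <-].
apply: (@le_trans _ _ (k%:E * (mdist x y)%:E)%E); first by rewrite lee_fin.
by rewrite lee_pmul2l ?lte_fin//; exact: mdist_le_diameter.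
Qed.

(** A separation of [B] cannot split [A], so one of its pieces contains [A];
    the closure of that piece contains [B], which leaves nothing for the other
    piece. *)
Lemma connected_sandwich (T : topologicalType) (A B : set T) :
  A `<=` B -> B `<=` closure A -> connected A -> connected B.
Proof.
move=> AB BA cA; apply/connectedP => E [E0 BE sE].
have AE : A `<=` E false `|` E true by rewrite -BE.
have [AF|AT] := connected_subset sE AE cA.
- have [x Ex] := E0 true; have Bx : B x by rewrite BE; right.
  have : (closure (E false) `&` E true) x.
    by split => //; apply: closureS AF _ _; exact: BA.
  by rewrite sE.1.
- have [x Ex] := E0 false; have Bx : B x by rewrite BE; left.
  have : (E false `&` closure (E true)) x.
    by split => //; apply: closureS AT _ _; exact: BA.
  by rewrite sE.2.
Qed.

Lemma connected_pairwise (T : topologicalType) (A : set T) :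
  (forall x y, A x -> A y ->
    exists C, [/\ C x, C y, C `<=` A & connected C]) -> connected A.
Proof.
move=> AC; have [[a Aa]|/nonemptyPn ->] := pselect (A !=set0); last exact: connected0.
rewrite (_ : A = connected_component A a); first exact: component_connected.
apply/seteqP; split; last exact: connected_component_sub.
by move=> x /(AC a x Aa)[C [Ca Cx CA cC]]; exists C.
Qed.

End metric_facts.

Lemma exprV2_lt {R : realType} (e : R) : 0 < e ->
  exists N, forall n, (N <= n)%N -> (2 ^+ n)^-1 < e.
Proof.
move=> e0.
have h : `|2^-1 : R| < 1 by rewrite ger0_norm// invf_lt1// ltr1n.
have /cvgrPdist_lt /(_ e e0) [N _ Ne] := cvg_expr h.
exists N => n /Ne /=.
by rewrite sub0r normrN exprVn ger0_norm// invr_ge0 exprn_ge0.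
Qed.

Lemma finite_set_nat_bounded (A : set nat) : finite_set A ->
  exists N, forall n, A n -> (n < N)%N.
Proof.
move=> /finite_fsetP[B ->]; exists (\max_(i <- finmap.enum_fset B) i).+1 => n /= nB.
by rewrite ltnS; exact: leq_bigmax_seq.
Qed.

(** * The metric of the countable product *)

Section countable_prod.
Context {R : realType} (X : nat -> metricType R)
  (X1 : forall n, bounded_by1 (X n)).
Local Notation P := (countable_prod X1).
Implicit Types x y z p : P.

(** As a function of [t], the slice through [p] in direction [n]; the type [P]
    of the result is what selects the product metric. *)
Definition upd p n (t : X n) : P := dfwith p n t.

Lemma mdist_coord_le n x y : mdist (x n) (y n) <= 2 ^+ n * mdist x y.
Proof.
rewrite mulrC -ler_pdivrMr ?exprn_gt0// mulrC.
exact: (prod_term_le_dist x y n).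
Qed.

Lemma mdist_upd p n (s t : X n) :
  mdist (upd p n s) (upd p n t) <= (2 ^+ n)^-1 * mdist s t.
Proof.
apply: limr_le; first exact: is_cvg_prod_term.
apply: nearW => m; rewrite /series /=.
have h0 i : i != n -> prod_term (upd p n s) (upd p n t) i = 0.
  by move=> ni; rewrite /prod_term /upd !dfwithout 1?eq_sym// mdistxx mulr0.
have [mn|nm] := leqP m n.
  rewrite big_nat big1 ?mulr_ge0 ?mdist_ge0 ?invr_ge0 ?exprn_ge0// => i /andP[_ im].
  by rewrite h0// ltn_eqF// (leq_trans im).
rewrite (bigD1_seq n) ?mem_index_iota ?iota_uniq//= big1 ?addr0//.
by rewrite /prod_term /upd !dfwithin.
Qed.

(** The weights [2 ^ -n] add up to 2, and those from [N] on to
    [2 * 2 ^ -N]; beyond [N] each coordinate distance is at most 1. *)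
Lemma mdist_prod_le (e : R) N x y : 0 <= e ->
  (forall n, (n < N)%N -> mdist (x n) (y n) <= e) ->
  mdist x y <= 2 * e + 2 * (2 ^+ N)^-1.
Proof.
move=> e0 xye; apply: limr_le; first exact: is_cvg_prod_term.
have half : 1 - 2^-1 = 2^-1 :> R by lra.
have geo (a : R) n : 0 <= a -> series (geometric a 2^-1) n <= 2 * a.
  move=> a0; have := @geometric_le_lim R n a 2^-1 a0.
  by rewrite half invrK mulrC; apply; rewrite ?ger0_norm ?invf_lt1 ?ltr1n.
exists N => // m /= Nm.
rewrite /series /= (big_cat_nat (leq0n N) Nm)/=; apply: lerD.
- apply: le_trans (geo e N e0); rewrite /series /= big_nat [leRHS]big_nat.
  apply: ler_sum => i /andP[_ iN].
  by rewrite /prod_term /geometric /= exprVn mulrC ler_wpM2r ?invr_ge0 ?exprn_ge0 ?xye.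
- rewrite -(subnKC Nm) -exprVn.
  apply: le_trans (geo _ (m - N)%N _); last by rewrite exprn_ge0.
  rewrite -geometric_partial_tail; apply: ler_sum => i _.
  rewrite /prod_term exprVn ler_piMr ?invr_ge0 ?exprn_ge0//; exact: X1.
Qed.

(** In the component of a point [a] of the product set lie all the points [xk]
    that follow [x] before [k] and [a] from [k] on, since [xk k] and
    [xk k.+1] are on a common slice; and [xk] converges to [x]. *)
Lemma connected_prod (A : forall n, set (X n)) :
  (forall n, connected (A n)) -> connected [set x : P | forall n, A n (x n)].
Proof.
move=> cA; set B := (X in connected X).
have [[a Ba]|/nonemptyPn ->] := pselect (B !=set0); last exact: connected0.
apply: (@connected_sandwich _ (connected_component B a)); last exact: component_connected.
  exact: connected_component_sub.
move=> x Bx.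
pose xk k : P := fun n => if (n < k)%N then x n else a n.
have Bxk k n : A n (xk k n) by rewrite /xk; case: ifP.
have axk k : connected_component B a (xk k).
  elim: k => [|k /connected_component_trans]; first exact: connected_component_refl.
  apply; exists (upd (xk k) k @` A k).
    split.
    - exists (a k) => //; apply/functional_extensionality_dep => n.
      by rewrite /upd; case: dfwithP => // ; rewrite /xk ltnn.
    - move=> _ [t At <-] n; rewrite /upd; case: dfwithP => // i _; exact: Bxk.
    - apply: connected_continuous_connected => //.
      apply: continuous_subspaceT.
      apply: (@lipschitz_continuous _ _ _ (2 ^+ k)^-1).
        by rewrite invr_gt0 exprn_gt0.
      exact: mdist_upd.
  exists (x k) => //; apply/functional_extensionality_dep => n.
  rewrite /upd; case: dfwithP => [|i ki]; rewrite /xk ?leqnn// ltnS (leq_eqVlt i).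
  by rewrite [i == k]eq_sym (negbTE ki).
move=> V /nbhs_ballP[e /= e0 eV].
have [N /(_ N (leqnn N)) Ne] : exists N, forall n, (N <= n)%N -> (2 ^+ n)^-1 < e / 2.
  by apply: exprV2_lt; rewrite divr_gt0.
exists (xk N); split; first exact: axk.
apply: eV; rewrite ballEmdist /=.
apply: (@le_lt_trans _ _ (2 * 0 + 2 * (2 ^+ N)^-1)); last by lra.
by apply: mdist_prod_le => // n nN; rewrite /xk nN mdistxx.
Qed.

(** * Uniform local connectedness of the product and of its factors *)

(** That [d] is the same for all [n] is the point: for a fixed factor it yields
    that this factor is ULC, and for [n] growing it reaches all pairs of points
    of the factor. *)
Lemma ULC_prod_coord p (e : R) : ULC P -> 0 < e ->
  exists2 d : R, 0 < d & forall n (s t : X n), mdist s t < 2 ^+ n * d ->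
    exists A, [/\ A s, A t, connected A & (diameter A < (2 ^+ n * e)%:E)%E].
Proof.
move=> ulcP e0; have [d d0 dP] := ulcP e e0; exists d => // n s t st.
have n0 : 0 < 2 ^+ n :> R by rewrite exprn_gt0.
have [|A [As At cA dA]] := dP (upd p n s) (upd p n t).
  apply: le_lt_trans (mdist_upd p n s t) _.
  by rewrite mulrC ltr_pdivrMr// mulrC.
have [cA' dA'] := @lipschitz_image _ _ _ _ _ (fun x : P => x n) _ n0
  (mdist_coord_le n) cA dA.
exists ((fun x : P => x n) @` A); split => //.
- by exists (upd p n s) => //; rewrite /upd dfwithin.
- by exists (upd p n t) => //; rewrite /upd dfwithin.
Qed.

Lemma ULC_coord p n : ULC P -> ULC (X n).
Proof.
move=> ulcP e e0; have n0 : 0 < 2 ^+ n :> R by rewrite exprn_gt0.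
have [|d d0 dP] := @ULC_prod_coord p (e / 2 ^+ n) ulcP; first by rewrite divr_gt0.
exists (2 ^+ n * d); first by rewrite mulr_gt0.
by move=> s t /dP; rewrite mulrC divfK// gt_eqF.
Qed.

Lemma finite_disconnected_coord p : ULC P ->
  finite_set [set n | ~ connected [set: X n]].
Proof.
move=> ulcP; have [d d0 dP] := ULC_prod_coord p 1 ulcP ltr01.
have [N Nd] := exprV2_lt _ d0.
apply: sub_finite_set (finite_II N) => n /= ncX.
rewrite ltnNge; apply/negP => /Nd nd; apply: ncX.
(* the bound 1 on the distance is now below 2 ^ n * d *)
apply: connected_pairwise => s t _ _.
have [|A [As At cA _]] := dP n s t; last by exists A.
apply: le_lt_trans (X1 n s t) _.
by rewrite -ltr_pdivrMl ?exprn_gt0// mulr1.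
Qed.

(** The diameter [e] is shared out: the sets in the coordinates before [M], of
    diameter less than [e / 8], give at most [2 * (e / 8)], and the whole
    factors from [M] on at most [2 * 2 ^ -M < 2 * (e / 8)]. *)
Lemma ULC_prod N : (forall n, ULC (X n)) ->
  (forall n, (N <= n)%N -> connected [set: X n]) -> ULC P.
Proof.
move=> ulcX cX e e0; have e8 : 0 < e / 8 by rewrite divr_gt0.
have [M0 M0e] := exprV2_lt _ e8.
pose M := maxn M0 N.
have /choice[dl dlP] : forall n, exists d : R, 0 < d /\
    forall s t : X n, mdist s t < d ->
      exists A, [/\ A s, A t, connected A & (diameter A < (e / 8)%:E)%E].
  by move=> n; have [d d0 dP] := ulcX n _ e8; exists d.
exists (\big[Num.min/1]_(n < M) ((2 ^+ n)^-1 * dl n)).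
  apply: lt_bigmin => // i _.
  by rewrite mulr_gt0 ?(dlP i).1// invr_gt0 exprn_gt0.
move=> x y xyd.
have /(_ _)/cid-/all_tag[A AP] : forall n, exists A : set (X n),
    [/\ A (x n), A (y n), connected A &
        (n < M)%N -> (diameter A < (e / 8)%:E)%E].
  move=> n; have [nM|Mn] := ltnP n M; last first.
    by exists setT; split => //; apply: cX; exact: leq_trans (leq_maxr _ _) Mn.
  have [|A [Ax Ay cA dA]] := (dlP n).2 (x n) (y n); last by exists A.
  apply: le_lt_trans (mdist_coord_le n x y) _.
  rewrite -ltr_pdivlMl ?exprn_gt0//; apply: lt_le_trans xyd _.
  exact: (bigmin_le _ (Ordinal nM)).
exists [set z | forall n, A n (z n)]; split.
- by move=> n; have [] := AP n.
- by move=> n; have [] := AP n.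
- by apply: connected_prod => n; have [] := AP n.
apply: (@le_lt_trans _ _ (2 * (e / 8) + 2 * (2 ^+ M)^-1)%:E).
  apply: diameter_le => u v Au Av; rewrite lee_fin.
  apply: mdist_prod_le; first exact: ltW.
  move=> n nM; have [_ _ _ /(_ nM) dA] := AP n.
  by rewrite -lee_fin (le_trans (mdist_le_diameter (Au n) (Av n)))// ltW.
by rewrite lte_fin; have := M0e M (leq_maxl _ _); lra.
Qed.

End countable_prod.

Theorem theorem6p3 (R : realType) (X : nat -> metricType R)
    (X1 : forall n : nat, bounded_by1 (X n))
    (X0 : forall n : nat, [set: X n] !=set0) :
  ULC (countable_prod X1) <->
  (forall n : nat, ULC (X n)) /\
  finite_set [set n : nat | ~ connected [set: X n]].
Proof.
have p n : X n by have /cid[] := X0 n.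
split=> [ulcP|[ulcX /finite_set_nat_bounded[N NX]]].
  split; first by move=> n; exact: ULC_coord p n ulcP.
  exact: finite_disconnected_coord p ulcP.
apply: (@ULC_prod _ _ _ N) => // n Nn; apply: contrapT => /NX.
by rewrite ltnNge Nn.
Qed.
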